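(* Let $I_0$ be a nonempty finite set. For every $\mu\in F^0_*(I_0,\mathbb{C})$, the $\mathcal{H}_{I_0}$-module $M_*[\mu]$ is irreducible and satisfies Condition $C_{I_0}$. Conversely, every irreducible $\mathcal{H}_{I_0}$-module $W$ (of level $1$) satisfying Condition $C_{I_0}$ is isomorphic to $M_*[\mu]$ for some $\mu\in F^0_*(I_0,\mathbb{C})$.
   Context: All vector spaces are over $\mathbb{C}$. $\mathcal{H}_{I_0}$ is the Lie algebra with basis $\{\mathbf{p}_i,\mathbf{q}_i,\mathbf{k}\mid i\in I_0\}$ and brackets $[\mathbf{k},\mathcal{H}_{I_0}]=0$, $[\mathbf{p}_i,\mathbf{p}_j]=0=[\mathbf{q}_i,\mathbf{q}_j]$, $[\mathbf{p}_i,\mathbf{q}_j]=\delta_{ij}\mathbf{k}$. A module is of level $1$ if $\mathbf{k}$ acts as the identity. $F^0_*(I_0,\mathbb{C})$ is the set of functions $\mu:I_0\to\mathbb{C}$ with $\mu_i\notin\mathbb{Z}$ for all $i\in I_0$. For a function $\mu:I_0\to\mathbb{C}$ let $\mathbf{x}^\mu=\prod_{i\in I_0}x_i^{\mu_i}$ be a formal monomial in the mutually commuting formal variables $x_i$ $(i\in I_0)$; the space with basis all $\mathbf{x}^\mu$ is an $\mathcal{H}_{I_0}$-module of level $1$ with $\mathbf{p}_i$ acting as the formal partial derivative $\partial/\partial x_i$, $\mathbf{q}_i$ as multiplication by $x_i$, and $\mathbf{k}$ as the identity. For $\mu\in F^0_*(I_0,\mathbb{C})$, $M_*[\mu]=\mathbf{x}^\mu\,\mathbb{C}[x_i^{\pm1}\mid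 i\in I_0]$, i.e. the span of all $\mathbf{x}^{\mu+\lambda}$ with $\lambda:I_0\to\mathbb{Z}$, which is an $\mathcal{H}_{I_0}$-submodule. An $\mathcal{H}_{I_0}$-module $W$ of level $1$ satisfies Condition $C_{I_0}$ if for every $i\in I_0$ the operator $\mathbf{q}_i\mathbf{p}_i$ is semisimple (diagonalizable) on $W$, and $\mathbf{p}_iw\neq0$, $\mathbf{q}_iw\ne0$ for every $0\neq w\in W$. *)

(* Defs.v *)
From HB Require Import structures.
From mathcomp Require Import all_boot all_order all_algebra.
From mathcomp Require Import ssrAC.
From mathcomp Require Import finmap monalg.
From mathcomp Require Import boolp classical_sets.

Set Implicit Arguments.
Unset Strict Implicit.
Unset Printing Implicit Defensive.

Import GRing.Theory.

Local Open Scope classical_set_scope.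
Local Open Scope ring_scope.

Section LinearAlgebra.
Context {K : fieldType} {V : lmodType K}.

Definition lin_span (S : set V) : set V :=
  [set v | exists s : seq (K * V),
     (forall p, p \in s -> S p.2) /\ v = \sum_(p <- s) p.1 *: p.2].

Definition lin_indep (S : set V) : Prop :=
  forall s : seq V, uniq s -> (forall v, v \in s -> S v) ->
  forall c : V -> K, \sum_(v <- s) c v *: v = 0 ->
  forall v, v \in s -> c v = 0.

Definition is_lin_basis (B : set V) : Prop :=
  lin_indep B /\ lin_span B = setT.

Definition diagonalizable_op (f : V -> V) : Prop :=
  exists B : set V,
    is_lin_basis B /\ forall v, B v -> exists a : K, f v = a *: v.

Lemma lin_span_gen (S : set V) v : S v -> lin_span S v.
Proof.
move=> Sv; exists [:: (1, v)]; split; last by rewrite big_seq1 scale1r.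
by move=> p; rewrite inE => /eqP ->.
Qed.

Lemma lin_span0 (S : set V) : lin_span S 0.
Proof. by exists [::]; split=> //; rewrite big_nil. Qed.

Lemma lin_spanP (S : set V) a u v :
  lin_span S u -> lin_span S v -> lin_span S (a *: u + v).
Proof.
move=> [s [Ss ->]] [t [St ->]].
exists ([seq (a * p.1, p.2) | p <- s] ++ t); split.
  by move=> p; rewrite mem_cat => /orP[/mapP[q /Ss Sq ->]|/St].
rewrite big_cat big_map scaler_sumr; congr (_ + _).
by apply: eq_bigr => p _; rewrite scalerA.
Qed.

End LinearAlgebra.

Record lieAlg (K : fieldType) := LieAlg {
  lie_sort :> lmodType K;
  lie_br : lie_sort -> lie_sort -> lie_sort;
  lie_br_linearl : forall y, linear (lie_br^~ y);
  lie_br_linearr : forall x, linear (lie_br x);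
  lie_br_alt : forall x, lie_br x x = 0;
  lie_jacobi : forall x y z,
    lie_br x (lie_br y z) + lie_br y (lie_br z x) + lie_br z (lie_br x y) = 0
}.

Record lieModule (K : fieldType) (L : lieAlg K) := LieModule {
  lmd_sort :> lmodType K;
  act : L -> lmd_sort -> lmd_sort;
  act_linearl : forall v, linear (act^~ v);
  act_linearr : forall x, linear (act x);
  act_br : forall x y v, act (lie_br x y) v = act x (act y v) - act y (act x v)
}.

Arguments act {K L} l x v : rename.

Section LieModules.
Context {K : fieldType} {L : lieAlg K}.

Record is_submodule (V : lieModule L) (S : set V) : Prop := IsSubmodule {
  subm0 : S 0;
  submP : forall a u v, S u -> S v -> S (a *: u + v);
  subm_act : forall x v, S v -> S (act V x v)
}.

Definition irreducible (V : lieModule L) : Prop :=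
  (exists v : V, v != 0) /\
  forall S : set V, is_submodule S -> S = [set 0] \/ S = setT.

Definition isomorphic (V W : lieModule L) : Prop :=
  exists f : {linear V -> W},
    bijective f /\ forall x v, f (act V x v) = act W x (f v).

End LieModules.

(* A submodule S viewed as a module. The proof parameter of submType only
   serves to infer the vector space structure of the subtype. *)

Section Submodule.
Context {K : fieldType} {L : lieAlg K} (V : lieModule L) (S : set V).
Hypothesis subS : is_submodule S.

Definition subm_pred : pred V := fun v => `[< S v >].

Record submType (sS : is_submodule S) :=
  SubmElt { subm_val : V; subm_valP : subm_pred subm_val }.

Local Notation T := (submType subS).

HB.instance Definition _ := [isSub for @subm_val subS].
HB.instance Definition _ := [Choice of T by <:].

Fact subm_closed : subsemimod_closed subm_pred.
Proof.
split; first split.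
- by apply/asboolP; apply: (subm0 subS).
- move=> u v /asboolP Su /asboolP Sv; apply/asboolP.
  by rewrite -[u]scale1r; apply: (submP subS).
- move=> a v /asboolP Sv; apply/asboolP; rewrite -[_ *: _]addr0.
  by apply: (submP subS) => //; apply: (subm0 subS).
Qed.

HB.instance Definition _ :=
  GRing.SubChoice_isSubLmodule.Build K V subm_pred T subm_closed.

Fact subm_actP x (v : T) : subm_pred (act V x (\val v)).
Proof.
by apply/asboolP; apply: (subm_act subS); apply/asboolP; apply: (valP v).
Qed.

Definition subm_actf (x : L) (v : T) : T := SubmElt subS (subm_actP x v).

Fact subm_act_linearl v : linear (subm_actf^~ v).
Proof. by move=> a x y; apply: val_inj; rewrite linearP /= act_linearl. Qed.

Fact subm_act_linearr x : linear (subm_actf x).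
Proof.
move=> a u v; apply: val_inj; rewrite linearP /= -act_linearr.
by congr act; apply: (linearP (val : T -> V)).
Qed.

Fact subm_act_br x y v :
  subm_actf (lie_br x y) v =
  subm_actf x (subm_actf y v) - subm_actf y (subm_actf x v).
Proof. by apply: val_inj; rewrite linearB /= act_br. Qed.

Definition submodule_module : lieModule L :=
  LieModule subm_act_linearl subm_act_linearr subm_act_br.

End Submodule.

(* The Heisenberg Lie algebra: the triple (a, b, c) stands for
   \sum_i a_i p_i + \sum_i b_i q_i + c k. *)

Section Heisenberg.
Context (K : fieldType) (I : finType).

Definition heis_type : lmodType K :=
  ({ffun I -> K^o} * {ffun I -> K^o} * K^o)%type.

Definition heis_br (x y : heis_type) : heis_type :=
  (0, 0, \sum_i (x.1.1 i * y.1.2 i - x.1.2 i * y.1.1 i)).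

Fact heis_br_linearl y : linear (heis_br^~ y).
Proof.
move=> a x x'; rewrite /heis_br; congr (_, _, _); rewrite /= ?scaler0 ?addr0 //.
rewrite scaler_sumr -big_split; apply: eq_bigr => i _ /=.
rewrite !ffunE /= /GRing.scale /=.
by rewrite !mulrDl opprD addrACA mulrBr -!mulrA.
Qed.

Fact heis_br_alt x : heis_br x x = 0.
Proof.
by rewrite /heis_br big1 // => i _; rewrite mulrC subrr.
Qed.

Fact heis_br_linearr x : linear (heis_br x).
Proof.
move=> a y y'; rewrite /heis_br; congr (_, _, _); rewrite /= ?scaler0 ?addr0 //.
rewrite scaler_sumr -big_split; apply: eq_bigr => i _ /=.
rewrite !ffunE /= /GRing.scale /=.
by rewrite !mulrDr opprD addrACA mulrN !(mulrCA a).
Qed.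

Fact heis_br_nil x y z : heis_br x (heis_br y z) = 0.
Proof.
rewrite {1}/heis_br /= big1 // => i _.
by rewrite !ffunE !mulr0 subrr.
Qed.

Fact heis_jacobi x y z :
  heis_br x (heis_br y z) + heis_br y (heis_br z x) + heis_br z (heis_br x y)
  = 0.
Proof. by rewrite !heis_br_nil !addr0. Qed.

Definition heis : lieAlg K :=
  LieAlg heis_br_linearl heis_br_linearr heis_br_alt heis_jacobi.

Definition unit_fun (i : I) : {ffun I -> K^o} := [ffun j => (j == i)%:R].

Definition heis_p (i : I) : heis := (unit_fun i, 0, 0).
Definition heis_q (i : I) : heis := (0, unit_fun i, 0).
Definition heis_k : heis := (0, 0, 1).

Lemma heis_br_k x : lie_br heis_k x = 0.
Proof.
by rewrite /= /heis_br big1 // => i _; rewrite !ffunE !mul0r subrr.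
Qed.

Lemma heis_br_pp i j : lie_br (heis_p i) (heis_p j) = 0.
Proof.
by rewrite /= /heis_br big1 // => l _; rewrite !ffunE mul0r mulr0 subrr.
Qed.

Lemma heis_br_qq i j : lie_br (heis_q i) (heis_q j) = 0.
Proof.
by rewrite /= /heis_br big1 // => l _; rewrite !ffunE mul0r mulr0 subrr.
Qed.

Lemma heis_br_pq i j :
  lie_br (heis_p i) (heis_q j) = (i == j)%:R *: heis_k.
Proof.
rewrite /= /heis_br; congr (_, _, _); rewrite ?scaler0 //=.
rewrite (bigD1 i) //= big1 ?addr0 => [|l /negPf ne].
  by rewrite !ffunE eqxx mul1r mul0r subr0 /GRing.scale /= mulr1.
by rewrite !ffunE ne !mul0r subrr.
Qed.

Lemma heisE (x : heis) :
  x = \sum_i x.1.1 i *: heis_p i + \sum_i x.1.2 i *: heis_q i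
      + x.2 *: heis_k.
Proof.
have sump (J : finType) (F : J -> heis_type) : \sum_j F j =
   (\sum_j (F j).1.1, \sum_j (F j).1.2, \sum_j (F j).2).
  by rewrite unlock; elim: (index_enum J) => //= j s ->.
have sumu (f : {ffun I -> K^o}) : \sum_i f i *: unit_fun i = f.
  apply/ffunP=> j; rewrite sum_ffunE (bigD1 j) //= big1 => [|l /negPf ne].
    by rewrite !ffunE eqxx addr0 /GRing.scale /= mulr1.
  by rewrite !ffunE eq_sym ne scaler0.
have addE (u v w : heis_type) : u + v + w =
   (u.1.1 + v.1.1 + w.1.1, u.1.2 + v.1.2 + w.1.2, u.2 + v.2 + w.2) by [].
rewrite !sump addE; case: x => [[a b] c]; congr (_, _, _).
- by rewrite /= sumu big1 ?addr0 ?scaler0 ?addr0 // => i _; rewrite scaler0.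
- by rewrite /= sumu big1 ?add0r ?scaler0 ?addr0 // => i _; rewrite scaler0.
- rewrite /= !big1 ?add0r; first by rewrite /GRing.scale /= mulr1.
  all: by move=> i _; rewrite scaler0.
Qed.

Definition level1 (W : lieModule heis) : Prop :=
  forall w : W, act W heis_k w = w.

Record conditionC (W : lieModule heis) : Prop := ConditionC {
  condC_level1 : level1 W;
  condC_diag : forall i,
    diagonalizable_op (fun w : W => act W (heis_q i) (act W (heis_p i) w));
  condC_p : forall i (w : W), w != 0 -> act W (heis_p i) w != 0;
  condC_q : forall i (w : W), w != 0 -> act W (heis_q i) w != 0
}.

(* The level 1 module given by operators satisfying the canonical commutation
   relations, k acting as the identity. *)

Section CCRModule.
Context (V : lmodType K) (P Q : I -> {linear V -> V}).
Hypothesis PC : forall i j v, P i (P j v) = P j (P i v).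
Hypothesis QC : forall i j v, Q i (Q j v) = Q j (Q i v).
Hypothesis PQ : forall i j v, P i (Q j v) = Q j (P i v) + (i == j)%:R *: v.

Definition ccr_act (x : heis) (v : V) : V :=
  \sum_i x.1.1 i *: P i v + \sum_i x.1.2 i *: Q i v + x.2 *: v.

Local Notation comb F u v := (\sum_i u i *: F i v).

Fact combDl (F : I -> {linear V -> V}) a (s t : I -> K) v :
  comb F (fun i => a * s i + t i) v = a *: comb F s v + comb F t v.
Proof.
rewrite scaler_sumr -big_split; apply: eq_bigr => i _ /=.
by rewrite scalerDl scalerA.
Qed.

Fact combDr (F : I -> {linear V -> V}) (s : I -> K) a u v :
  comb F s (a *: u + v) = a *: comb F s u + comb F s v.
Proof.
rewrite scaler_sumr -big_split; apply: eq_bigr => i _ /=.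
by rewrite linearP scalerDr !scalerA mulrC.
Qed.

Fact combD3 (F : I -> {linear V -> V}) (s : I -> K) c u v w :
  comb F s (u + v + c *: w) = comb F s u + comb F s v + c *: comb F s w.
Proof.
by rewrite addrC combDr -[u]scale1r combDr !scale1r addrC.
Qed.

Fact comb_comb (F G : I -> {linear V -> V}) (s t : I -> K) v :
  comb F s (comb G t v) = \sum_i \sum_j (s i * t j) *: F i (G j v).
Proof.
apply: eq_bigr => i _; rewrite linear_sum scaler_sumr; apply: eq_bigr => j _.
by rewrite linearZ /= scalerA.
Qed.

Fact comb_comm (F : I -> {linear V -> V}) (s t : I -> K) v :
  (forall i j v, F i (F j v) = F j (F i v)) ->
  comb F s (comb F t v) = comb F t (comb F s v).
Proof.
move=> FC; rewrite !comb_comb exchange_big; apply: eq_bigr => j _.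
by apply: eq_bigr => i _; rewrite FC mulrC.
Qed.

Fact comb_ccr (s t : I -> K) v :
  comb P s (comb Q t v) = comb Q t (comb P s v) + (\sum_i s i * t i) *: v.
Proof.
rewrite !comb_comb [in RHS]exchange_big /= scaler_suml -big_split.
apply: eq_bigr => i _ /=.
transitivity (\sum_j ((t j * s i) *: Q j (P i v)
                      + (s i * t j * (i == j)%:R) *: v)).
  by apply: eq_bigr => j _; rewrite PQ scalerDr scalerA mulrC.
rewrite big_split /=; congr (_ + _).
rewrite (bigD1 i) //= big1 ?eqxx ?mulr1 ?addr0 // => j /negPf ne.
by rewrite eq_sym ne mulr0 scale0r.
Qed.

Fact ccr_act_linearl v : linear (ccr_act^~ v).
Proof.
move=> a x y; rewrite /ccr_act.
have -> : comb P (a *: x + y).1.1 v = a *: comb P x.1.1 v + comb P y.1.1 v.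
  by rewrite -combDl; apply: eq_bigr => i _; rewrite !ffunE.
have -> : comb Q (a *: x + y).1.2 v = a *: comb Q x.1.2 v + comb Q y.1.2 v.
  by rewrite -combDl; apply: eq_bigr => i _; rewrite !ffunE.
have -> : (a *: x + y).2 *: v = a *: (x.2 *: v) + y.2 *: v.
  by rewrite scalerA -scalerDl.
by rewrite !scalerDr [RHS]addrACA; congr (_ + _); apply: addrACA.
Qed.

Fact ccr_act_linearr x : linear (ccr_act x).
Proof.
move=> a u v; rewrite /ccr_act !combDr !scalerDr !scalerA [x.2 * a]mulrC.
by rewrite [RHS]addrACA; congr (_ + _); apply: addrACA.
Qed.

Fact ccr_act_br x y v :
  ccr_act (lie_br x y) v =
  ccr_act x (ccr_act y v) - ccr_act y (ccr_act x v).
Proof.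
have -> : ccr_act (lie_br x y) v =
    (\sum_i x.1.1 i * y.1.2 i - \sum_i y.1.1 i * x.1.2 i) *: v.
  rewrite /ccr_act big1 ?add0r => [|i _]; last by rewrite ffunE scale0r.
  rewrite big1 ?add0r => [|i _]; last by rewrite ffunE scale0r.
  rewrite -sumrB; congr (_ *: v); apply: eq_bigr => i _.
  by rewrite [_ * x.1.2 i]mulrC.
rewrite /ccr_act !combD3 !comb_ccr.
rewrite (comb_comm y.1.1 x.1.1 v PC) (comb_comm y.1.2 x.1.2 v QC).
rewrite !scalerDr !scalerA [y.2 * x.2]mulrC scalerBl.
move: (comb P x.1.1 (comb P y.1.1 v)) (comb Q y.1.2 (comb P x.1.1 v))
  (comb Q x.1.2 (comb P y.1.1 v)) (comb Q x.1.2 (comb Q y.1.2 v)) => pp qp pq qq.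
move: (y.2 *: comb P x.1.1 v) (y.2 *: comb Q x.1.2 v) (x.2 *: comb P y.1.1 v)
  (x.2 *: comb Q y.1.2 v) ((x.2 * y.2) *: v)
  ((\sum_i x.1.1 i * y.1.2 i) *: v) ((\sum_i y.1.1 i * x.1.2 i) *: v)
  => yp yq xp xq k s t.
rewrite !addrA [pp + qp + s + _ + _ + _ + _ + _ + _ + _](
  ACl (1*2*4*5*6*7*8*9*10*3)).
rewrite [pp + pq + t + _ + _ + _ + _ + _ + _ + _](
  ACl (1*5*8*2*6*9*4*7*10*3)).
by rewrite opprD addrACA subrr add0r.
Qed.

Definition ccr_module : lieModule heis :=
  LieModule ccr_act_linearl ccr_act_linearr ccr_act_br.

Lemma ccr_p i v : act ccr_module (heis_p i) v = P i v.
Proof.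
rewrite /= /ccr_act /= (bigD1 i) //= big1 => [|j /negPf ne].
  rewrite big1 => [|j _]; last by rewrite ffunE scale0r.
  by rewrite ffunE eqxx scale1r scale0r !addr0.
by rewrite ffunE ne scale0r.
Qed.

Lemma ccr_q i v : act ccr_module (heis_q i) v = Q i v.
Proof.
rewrite /= /ccr_act /= big1 => [|j _]; last by rewrite ffunE scale0r.
rewrite (bigD1 i) //= big1 => [|j /negPf ne].
  by rewrite ffunE eqxx scale1r scale0r !addr0 add0r.
by rewrite ffunE ne scale0r.
Qed.

Lemma ccr_level1 : level1 ccr_module.
Proof.
move=> v; rewrite /= /ccr_act /=.
by rewrite !big1 ?add0r ?scale1r // => i _; rewrite ffunE scale0r.
Qed.

End CCRModule.

(* The space with basis the formal monomials x^mu, mu : I -> K; the monomial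
   x^mu is the generator << mu >> of the free module {malg K[..]}. *)

Local Notation expo := {ffun I -> K^o}.

Definition monos : lmodType K := {malg K[expo]}.

Definition xmon (mu : expo) : monos := << mu >>.

Definition mon_ext (phi : expo -> monos) (f : monos) : monos :=
  \sum_(nu <- msupp (f : {malg K[expo]})) (f : {malg K[expo]})@_nu *: phi nu.

Definition dx (i : I) : monos -> monos :=
  mon_ext (fun mu => mu i *: xmon (mu - unit_fun i)).

Definition mulx (i : I) : monos -> monos :=
  mon_ext (fun mu => xmon (mu + unit_fun i)).

Lemma mon_extEw (phi : expo -> monos) (f : monos) (D : {fset expo}) :
  (msupp (f : {malg K[expo]}) `<=` D)%fset ->
  mon_ext phi f = \sum_(nu <- D) (f : {malg K[expo]})@_nu *: phi nu.
Proof.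
move=> sD; rewrite /mon_ext (big_fset_incl _ sD) // => nu _ /mcoeff_outdom ->.
by rewrite scale0r.
Qed.

Lemma mon_ext_linear phi : linear (mon_ext phi).
Proof.
move=> a f g.
pose D := (msupp (f : {malg K[expo]}) `|` msupp (g : {malg K[expo]}))%fset.
rewrite !(@mon_extEw phi _ D) ?fsubsetUl ?fsubsetUr //; last first.
  apply: fsubset_trans (msuppD_le _ _) _; apply: fsetSU; exact: msuppZ_le.
rewrite scaler_sumr -big_split; apply: eq_bigr => nu _ /=.
by rewrite mcoeffD mcoeffZ scalerDl scalerA.
Qed.

HB.instance Definition _ phi :=
  GRing.isLinear.Build K monos monos *:%R (mon_ext phi) (mon_ext_linear phi).
HB.instance Definition _ i := GRing.Linear.on (dx i).
HB.instance Definition _ i := GRing.Linear.on (mulx i).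

Lemma mon_ext_xmon phi mu : mon_ext phi (xmon mu) = phi mu.
Proof.
by rewrite (mon_extEw _ msuppU_le) big_seq_fset1 mcoeffUU scale1r.
Qed.

Lemma dx_xmon i mu : dx i (xmon mu) = mu i *: xmon (mu - unit_fun i).
Proof. exact: mon_ext_xmon. Qed.

Lemma mulx_xmon i mu : mulx i (xmon mu) = xmon (mu + unit_fun i).
Proof. exact: mon_ext_xmon. Qed.

Lemma xmonE (f : monos) :
  f = \sum_(nu <- msupp (f : {malg K[expo]}))
        (f : {malg K[expo]})@_nu *: xmon nu.
Proof.
rewrite {1}[f]monalgE; apply: eq_bigr => nu _; apply/malgP => l.
by rewrite mcoeffZ !mcoeffU mulr_natr.
Qed.

Lemma eq_on_xmon (phi psi : {linear monos -> monos}) :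
  (forall mu, phi (xmon mu) = psi (xmon mu)) -> phi =1 psi.
Proof.
move=> e f; rewrite [f]xmonE !linear_sum; apply: eq_bigr => nu _.
by rewrite !linearZ /= e.
Qed.

Lemma dxC i j f : dx i (dx j f) = dx j (dx i f).
Proof.
apply: (@eq_on_xmon (dx i \o dx j) (dx j \o dx i)) => mu /=.
rewrite !dx_xmon !linearZ /= !dx_xmon !scalerA !ffunE addrAC.
by have [-> //|ne] := eqVneq i j; rewrite !subr0 mulrC.
Qed.

Lemma mulxC i j f : mulx i (mulx j f) = mulx j (mulx i f).
Proof.
apply: (@eq_on_xmon (mulx i \o mulx j) (mulx j \o mulx i)) => mu /=.
by rewrite !mulx_xmon addrAC.
Qed.

Lemma dx_mulx i j f : dx i (mulx j f) = mulx j (dx i f) + (i == j)%:R *: f.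
Proof.
pose psi := (mulx j \o dx i) \+ ((i == j)%:R \*: idfun).
apply: (@eq_on_xmon (dx i \o mulx j) psi) => mu /=.
rewrite mulx_xmon !dx_xmon linearZ /= mulx_xmon [_ i]ffunE [X in _ + X]ffunE.
rewrite scalerDl [mu + _ - _]addrAC; congr (_ + _).
by have [->|] := eqVneq i j; [rewrite addrNK | rewrite !scale0r].
Qed.

Definition monos_module : lieModule heis := ccr_module dxC mulxC dx_mulx.

(* Mstar mu is a submodule for every mu; non-integrality of mu is the separate
   condition F0star. *)

Definition int_shift (mu : expo) (lam : {ffun I -> int}) : expo :=
  [ffun i => mu i + (lam i)%:~R].

Definition Mstar_space (mu : expo) : set monos :=
  lin_span [set xmon (int_shift mu lam) | lam in [set: {ffun I -> int}]].

Fact Mstar_submodule mu : is_submodule (Mstar_space mu : set monos_module).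
Proof.
have lift (F : {linear monos -> monos}) :
    (forall lam, Mstar_space mu (F (xmon (int_shift mu lam)))) ->
    forall v, Mstar_space mu v -> Mstar_space mu (F v).
  move=> FM v [s [Ss ->]]; rewrite linear_sum big_seq.
  elim/big_rec: _ => [|p u /Ss [lam _ e] Mu]; first exact: lin_span0.
  by rewrite linearZ -e; apply: lin_spanP => //; apply: FM.
have MZ a v : Mstar_space mu v -> Mstar_space mu (a *: v).
  by move=> Mv; rewrite -[_ *: _]addr0; apply: lin_spanP => //; apply: lin_span0.
have MD u v : Mstar_space mu u -> Mstar_space mu v -> Mstar_space mu (u + v).
  by move=> Mu Mv; rewrite -[u]scale1r; apply: lin_spanP.
have Msum (F : I -> monos) :
    (forall i, Mstar_space mu (F i)) -> Mstar_space mu (\sum_i F i).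
  move=> MF; elim/big_rec: _ => [|i u _]; first exact: lin_span0.
  exact: MD.
have Mshift lam i (e : int) (E : expo) : E =1 (fun j => e%:~R * unit_fun i j) ->
    Mstar_space mu (xmon (int_shift mu lam + E)).
  move=> EE; apply: lin_span_gen.
  exists [ffun j => lam j + e * (j == i)%:R] => //.
  congr xmon; apply/ffunP=> j; rewrite !ffunE EE ffunE intrD intrM addrA.
  by case: (j == i).
split; [exact: lin_span0 | by move=> a u v; apply: lin_spanP |].
move=> x v Mv; apply: (MD); last exact: MZ.
apply: (MD); apply: (Msum) => i; apply: (MZ); apply: (lift) => // lam.
  rewrite /= dx_xmon; apply: (MZ); apply: (Mshift _ i (-1)) => j.
  by rewrite ffunE mulN1r.
by rewrite /= mulx_xmon; apply: (Mshift _ i 1) => j; rewrite mul1r.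
Qed.

Definition Mstar (mu : expo) : lieModule heis :=
  submodule_module (Mstar_submodule mu).

Definition F0star (mu : expo) : Prop :=
  forall i (z : int), mu i <> z%:~R.

End Heisenberg.

(* Main.v *)
(* Everything rests on the commuting Euler operators q_i p_i. If they are
   diagonalizable, every nonzero submodule contains a joint eigenvector. In
   M_*[mu] a joint eigenvector is a multiple of a single monomial, and for
   non-integral mu the p_i and q_i move any monomial to any other up to a nonzero
   scalar: hence irreducibility. Conversely, let u in W be a joint eigenvector, of
   eigenvalue mu. Under Condition C each q_i p_i is bijective, hence so is each
   q_i, and sending x^(mu + lam) to q^lam u, for lam an integer vector, defines
   a nonzero morphism M_*[mu] -> W between irreducible modules. *)

From HB Require Import structures.
Require Import Defs.
From mathcomp Require Import all_boot all_order all_algebra.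
From mathcomp Require Import finmap monalg boolp classical_sets.
From mathcomp Require Import reals complex.

Set Implicit Arguments.
Unset Strict Implicit.
Unset Printing Implicit Defensive.

Import GRing.Theory Num.Theory.

Local Open Scope ring_scope.

(** * Diagonalizable operators *)

(** Stability under every [f - a] is a condition met by a submodule as well as by its joint
    eigenvectors for operators commuting with [f]. *)
Lemma eigenvector_of_diagonalizable (K : fieldType) (V : lmodType K)
    (f : {linear V -> V}) (S : set V) (w : V) :
  diagonalizable_op f -> (forall a u, S u -> S (f u - a *: u)) ->
  S w -> w != 0 -> exists a u, [/\ S u, u != 0 & f u = a *: u].
Proof.
move=> [B [[_ spanB] eigB]] Sf Sw w0.
have /= [s [Bs def_w]] : lin_span B w by rewrite spanB.
have {Bs} : forall p, p \in s -> exists a, f p.2 = a *: p.2.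
  by move=> p /Bs /eigB.
(* f - a keeps w in S and removes one eigenvector from its decomposition. *)
move: {2}(size s) (erefl (size s)) => n.
elim: n s w Sw w0 def_w => [|n IHn] [|p s] //= w Sw w0 def_w.
  by rewrite def_w big_nil eqxx in w0.
move=> [sz_s] eig_s.
have [a fp] := eig_s p (mem_head _ _).
have [fw0|fw0] := eqVneq (f w - a *: w) 0.
  by exists a, w; split=> //; apply/eqP; rewrite -subr_eq0 fw0.
(* With membership inside the existential and 0 as default, [choice] yields an eigenvalue function
   on all pairs. *)
have eig (q : K * V) : exists b, q \in s -> f q.2 = b *: q.2.
  have [qs|_] := boolP (q \in s); last by exists 0.
  by have [|b ?] := eig_s q; [rewrite inE qs orbT | exists b].
have [b fb] := choice eig.
apply: (IHn [seq ((b q - a) * q.1, q.2) | q <- s] _ (Sf a w Sw) fw0).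
- rewrite def_w linear_sum scaler_sumr -sumrB big_cons linearZ /= fp.
  rewrite !scalerA mulrC subrr add0r big_map big_seq [RHS]big_seq.
  apply: eq_bigr => q qs; rewrite linearZ /= fb // !scalerA -scalerBl.
  by rewrite mulrBl [b q * _]mulrC.
- by rewrite size_map.
- by move=> _ /mapP[q qs ->]; exists (b q) => /=; apply: fb.
Qed.

(** Injectivity makes the eigenvalues nonzero, so an expansion in eigenvectors can be divided by
    them term by term. *)
Lemma diagonalizable_surjective (K : fieldType) (V : lmodType K)
    (f : {linear V -> V}) :
  diagonalizable_op f -> (forall v, v != 0 -> f v != 0) ->
  forall v, exists u, f u = v.
Proof.
move=> [B [[_ spanB] eigB]] f0 v.
have /= [s [Bs ->]] : lin_span B v by rewrite spanB.
rewrite big_seq; elim/big_rec: _ => [|p u /Bs /eigB [a fp] [u' <-]].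
  by exists 0; rewrite linear0.
have [->|p0] := eqVneq p.2 0; first by exists u'; rewrite scaler0 add0r.
have a0 : a != 0.
  by apply: contraNneq (f0 _ p0) => a0; rewrite fp a0 scale0r.
exists ((p.1 / a) *: p.2 + u').
by rewrite linearD linearZ /= fp scalerA divfK.
Qed.

(** * The lattice of integer vectors *)

Section Lattice.
Context {I : finType}.

Definition int_unit (i : I) : {ffun I -> int} := [ffun j => (j == i)%:R].

(** Unit steps, one coordinate at a time, join any two integer vectors. *)
Lemma lattice_ind (P : {ffun I -> int} -> Prop) :
  (forall lam i, P lam -> P (lam + int_unit i)) ->
  (forall lam i, P lam -> P (lam - int_unit i)) ->
  forall lam0, P lam0 -> forall lam, P lam.
Proof.
move=> PD PB lam0 P0 lam.
have step i (z : int) l : P l -> P (l + int_unit i *~ z).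
  elim/int_ind: z l => [|n IHn|n IHn] l Pl; first by rewrite addr0.
    by rewrite intS mulrzDr addrA; apply/IHn/PD.
  by rewrite intS opprD mulrzDr mulrN1z addrA; apply/IHn/PB.
have -> : lam = lam0 + \sum_i int_unit i *~ (lam - lam0) i.
  rewrite addrC; apply/eqP; rewrite -subr_eq; apply/eqP/ffunP=> j.
  rewrite sum_ffunE (bigD1 j) //= big1 => [|i /negPf ne].
    by rewrite ffunMzE !ffunE eqxx addr0 -mulrzl mulr1 intz.
  by rewrite ffunMzE !ffunE eq_sym ne mul0rz.
elim: (index_enum I) => [|i s IHs]; first by rewrite big_nil addr0.
by rewrite big_cons addrCA addrC; apply: step.
Qed.

(** [wl lam] is f^lam w. The recursion over all integer vectors covers negative powers too, without
    naming inverses. *)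
Lemma int_powers (V : Type) (f : I -> V -> V) :
  (forall i, bijective (f i)) -> (forall i j v, f i (f j v) = f j (f i v)) ->
  forall w, exists wl : {ffun I -> int} -> V,
    wl 0 = w /\ forall i lam, wl (lam + int_unit i) = f i (wl lam).
Proof.
move=> bij_f fC w.
have inv_f i : exists g, cancel (f i) g /\ cancel g (f i).
  by have [g] := bij_f i; exists g.
have [g gP] := choice inv_f.
have fK i := (gP i).1; have gK i := (gP i).2.
have fgC i j v : f i (g j v) = g j (f i v).
  by apply: (can_inj (fK j)); rewrite gK fC gK.
(* [Negz n] is -(n+1), hence [n.+1] iterations of the inverse. *)
pose pow i (z : int) v :=
  match z with Posz n => iter n (f i) v | Negz n => iter n.+1 (g i) v end.
have powS i z v : pow i (z + 1) v = f i (pow i z v).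
  case: z => [n|[|n]]; first by rewrite -PoszD addn1.
    by rewrite /= gK.
  have -> : Negz n.+1 + 1 = Negz n.
    by rewrite !NegzE (intS n.+1) opprD addrAC addNr add0r.
  by rewrite /= gK.
have powC i j z v : f i (pow j z v) = pow j z (f i v).
  by case: z => n; rewrite /pow; [elim: n | elim: n.+1] => //= m <-.
pose wl s (lam : {ffun I -> int}) := foldr (fun i v => pow i (lam i) v) w s.
exists (wl (enum I)); split=> [|i lam].
  by rewrite /wl; elim: (enum I) => //= j s ->; rewrite ffunE.
have: i \in enum I by rewrite mem_enum.
have wl_notin s : i \notin s -> wl s (lam + int_unit i) = wl s lam.
  elim: s => //= j s IHs; rewrite inE => /norP[/negPf ne /IHs ->].
  by rewrite !ffunE eq_sym ne addr0.
(* The index [i] occurs once: there [powS] adds one power, and [powC] carries [f i] outwards past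
   the other factors. *)
elim: (enum I) (enum_uniq I) => //= j s IHs /andP[js /IHs {}IHs].
rewrite inE; have [ij _|ne /=] := eqVneq i j.
  by rewrite ij in wl_notin *; rewrite wl_notin // !ffunE eqxx -powS.
by move=> /IHs ->; rewrite !ffunE eq_sym (negPf ne) addr0 powC.
Qed.

End Lattice.

Arguments act : simpl never.

HB.instance Definition _ (K : fieldType) (L : lieAlg K) (V : lieModule L)
    (x : L) :=
  GRing.isLinear.Build K V V *:%R (act V x) (act_linearr x).

(** * Level 1 modules and their Euler operators *)

Section HeisModule.
Context {K : fieldType} {I : finType} (W : lieModule (heis K I)).

Notation P i := (act W (heis_p K i)).
Notation Q i := (act W (heis_q K i)).

Lemma act_combl a x y v : act W (a *: x + y) v = a *: act W x v + act W y v.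
Proof. exact: act_linearl. Qed.

Lemma act0 v : act W 0 v = 0.
Proof.
by have := act_combl 1 0 0 v; rewrite !scale1r addr0 => /esym/eqP;
  rewrite -subr_eq0 addrK => /eqP.
Qed.

Lemma act_scale a x v : act W (a *: x) v = a *: act W x v.
Proof. by rewrite -[a *: x]addr0 act_combl act0 addr0. Qed.

Lemma act_add x y v : act W (x + y) v = act W x v + act W y v.
Proof. by rewrite -[x]scale1r act_combl !scale1r. Qed.

Lemma act_sum (J : finType) (F : J -> heis K I) v :
  act W (\sum_j F j) v = \sum_j act W (F j) v.
Proof.
elim: (index_enum J) => [|j s IHs]; first by rewrite !big_nil act0.
by rewrite !big_cons act_add IHs.
Qed.

Lemma act_pC i j v : P i (P j v) = P j (P i v).
Proof. by apply/eqP; rewrite -subr_eq0 -act_br heis_br_pp act0. Qed.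

Lemma act_qC i j v : Q i (Q j v) = Q j (Q i v).
Proof. by apply/eqP; rewrite -subr_eq0 -act_br heis_br_qq act0. Qed.

Hypothesis W1 : level1 W.

(** Through this formula, a linear map between level 1 modules is a morphism once it commutes with
    the p_i and q_i. *)
Lemma actE x v :
  act W x v = \sum_i x.1.1 i *: P i v + \sum_i x.1.2 i *: Q i v + x.2 *: v.
Proof.
rewrite {1}[x]heisE !act_add !act_sum act_scale W1.
by congr (_ + _ + _); apply: eq_bigr => i _; rewrite act_scale.
Qed.

Lemma act_pq i j v : P i (Q j v) = Q j (P i v) + (i == j)%:R *: v.
Proof.
by apply/eqP; rewrite addrC -subr_eq -act_br heis_br_pq act_scale W1.
Qed.

Definition euler i : W -> W := Q i \o P i.

HB.instance Definition _ i := GRing.Linear.on (euler i).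

Lemma eulerE i v : euler i v = Q i (P i v).
Proof. by []. Qed.

(** Ladder relation: q_j raises the j-th Euler eigenvalue by one, and p_j lowers it in [euler_p]. *)
Lemma euler_q i j v :
  euler i (Q j v) = Q j (euler i v + (i == j)%:R *: v).
Proof.
rewrite /euler /= act_pq !linearD /= !linearZ /= act_qC; congr (_ + _).
by have [->//|] := eqVneq i j; rewrite !scale0r.
Qed.

Lemma euler_p i j v :
  euler i (P j v) = P j (euler i v) - (i == j)%:R *: P j v.
Proof.
rewrite /euler /= act_pq act_pC eq_sym.
by have [->|] := eqVneq i j; rewrite ?scale0r ?subr0 ?addr0 // addrK.
Qed.

(** The shifts caused by q_j and p_j cancel in q_j p_j. *)
Lemma eulerC i j v : euler i (euler j v) = euler j (euler i v).
Proof.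
by rewrite {2}/euler /= euler_q euler_p addrNK.
Qed.

Lemma joint_eigenvector (S : set W) w :
  is_submodule S -> (forall i, diagonalizable_op (euler i)) ->
  S w -> w != 0 ->
  exists (a : {ffun I -> K}) u,
    [/\ S u, u != 0 & forall i, euler i u = a i *: u].
Proof.
move=> subS diag Sw w0.
have [a [u [Su u0 au]]] : exists (a : I -> K) u,
    [/\ S u, u != 0 & forall i, i \in enum I -> euler i u = a i *: u].
  elim: (enum I) => [|i s [a [u [Su u0 au]]]].
    by exists (fun=> 0), w; split.
  (* The vectors of [S] with the eigenvalues found so far; [eulerC] makes this set stable under
     [euler i - b]. *)
  pose E (v : W) := S v /\ forall j, j \in s -> euler j v = a j *: v.
  have Ef b v : E v -> E (euler i v - b *: v).
    move=> [Sv av]; split=> [|j js].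
      rewrite addrC -scaleNr; apply: (submP subS) => //.
      by do 2!apply: (subm_act subS).
    rewrite linearB linearZ /= eulerC av // linearZ /= scalerBr !scalerA.
    by rewrite [a j * b]mulrC.
  have [b [v [[Sv av] v0 bv]]] :=
    eigenvector_of_diagonalizable (diag i) Ef (conj Su au) u0.
  exists (fun j => if j == i then b else a j), v; split=> // j.
  by rewrite inE; case: eqVneq => [-> //|_ /= /av].
exists (finfun a), u; split=> // i; rewrite ffunE; apply: au.
by rewrite mem_enum.
Qed.

End HeisModule.

(** * Coefficients of formal monomials *)

Section Monomials.
Context {K : fieldType} {I : finType}.
Local Notation expo := {ffun I -> K^o}.
Implicit Types (mu nu : expo) (lam : {ffun I -> int}) (f : monos K I).

Definition mon_coef nu f : K := (f : {malg K[expo]})@_nu.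

Fact mon_coef_linear nu : linear_for *%R (mon_coef nu).
Proof. by move=> a f g; rewrite /mon_coef mcoeffD mcoeffZ. Qed.

HB.instance Definition _ nu :=
  GRing.isLinear.Build K (monos K I) K *%R (mon_coef nu) (mon_coef_linear nu).

Lemma mon_coef_xmon nu mu : mon_coef nu (xmon mu) = (mu == nu)%:R.
Proof. by rewrite /mon_coef mcoeffU. Qed.

Lemma mon_coefP f g : (forall nu, mon_coef nu f = mon_coef nu g) -> f = g.
Proof. by move=> fg; apply/malgP. Qed.

Lemma mon_coef_sum nu f (phi : expo -> monos K I) :
  mon_coef nu (mon_ext phi f) =
  \sum_(mu <- msupp (f : {malg K[expo]})) mon_coef mu f * mon_coef nu (phi mu).
Proof. by rewrite linear_sum; apply: eq_bigr => mu _; rewrite linearZ. Qed.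

Lemma mon_coef_mulx i nu f :
  mon_coef nu (mulx i f) = mon_coef (nu - unit_fun K i) f.
Proof.
rewrite mon_coef_sum [in RHS](xmonE f) linear_sum; apply: eq_bigr => mu _.
by rewrite linearZ /= !mon_coef_xmon eq_sym -subr_eq eq_sym.
Qed.

(** The monomial contributing at [nu] has i-th exponent [nu i + 1], which differentiation brings
    down. *)
Lemma mon_coef_dx i nu f :
  mon_coef nu (dx i f) = (nu i + 1) * mon_coef (nu + unit_fun K i) f.
Proof.
rewrite mon_coef_sum [in RHS](xmonE f) linear_sum mulr_sumr.
apply: eq_bigr => mu _; rewrite !linearZ /= !mon_coef_xmon subr_eq mulrCA.
by case: eqP => [->|_]; rewrite ?mulr0 // !ffunE eqxx.
Qed.

Lemma mon_coef_mulx_dx i nu f :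
  mon_coef nu (mulx i (dx i f)) = nu i * mon_coef nu f.
Proof. by rewrite mon_coef_mulx mon_coef_dx !ffunE eqxx !subrK. Qed.

(** Turns membership in a span into a support condition, testable on single coefficients. *)
Lemma Mstar_spaceP mu f :
  Mstar_space mu f <->
  (forall nu, mon_coef nu f != 0 -> exists lam, nu = int_shift mu lam).
Proof.
split=> [[s [Ms ->]] nu|supp_f].
  move/eqP=> nz; apply: contrapT => no; apply: nz.
  rewrite linear_sum big_seq big1 // => p /Ms [lam _ <-].
  rewrite linearZ /= mon_coef_xmon; case: eqP => [E|_]; last by rewrite mulr0.
  by case: no; exists lam.
rewrite [f]xmonE big_seq; elim/big_rec: _ => [|nu u]; first exact: lin_span0.
rewrite -mcoeff_neq0 => /supp_f [lam ->] Mu; apply: lin_spanP => //.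
by apply: lin_span_gen; exists lam.
Qed.

Hypothesis intK_inj : injective (fun z : int => z%:~R : K).

Lemma int_shift_inj mu : injective (int_shift mu).
Proof.
move=> l m /ffunP lm; apply/ffunP => i; have := lm i.
by rewrite !ffunE => /addrI /intK_inj.
Qed.

Lemma int_shiftD mu lam i :
  int_shift mu (lam + int_unit i) = int_shift mu lam + unit_fun K i.
Proof. by apply/ffunP=> j; rewrite !ffunE intrD addrA; case: (j == i). Qed.

Lemma int_shiftB mu lam i :
  int_shift mu (lam - int_unit i) = int_shift mu lam - unit_fun K i.
Proof. by rewrite -[in RHS](subrK (int_unit i) lam) int_shiftD addrK. Qed.

(** Non-integrality enters here: no derivative kills a monomial of M_*[mu]. *)
Lemma int_shift_neq0 mu lam i : F0star mu -> int_shift mu lam i != 0.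
Proof.
move=> mu0; rewrite ffunE addr_eq0; apply/eqP => e.
by apply: (mu0 i (- lam i)); rewrite intrN.
Qed.

(** * Condition C and irreducibility of M_*[mu] *)

Section Mstar.
Variable mu : expo.
Local Notation M := (Mstar mu).

Definition Mstar_val (v : M) : monos K I := subm_val v.

Local Arguments Mstar_val : simpl never.

Fact Mstar_val_linear : linear Mstar_val.
Proof. exact: (linearP \val). Qed.

HB.instance Definition _ :=
  GRing.isLinear.Build K M (monos K I) *:%R Mstar_val Mstar_val_linear.

Lemma Mstar_valZ a v : Mstar_val (a *: v) = a *: Mstar_val v.
Proof. exact: linearZ. Qed.

Lemma Mstar_val_sum (J : Type) (r : seq J) (F : J -> M) :
  Mstar_val (\sum_(j <- r) F j) = \sum_(j <- r) Mstar_val (F j).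
Proof. exact: linear_sum. Qed.

Lemma Mstar_val_inj : injective Mstar_val.
Proof. exact: val_inj. Qed.

Lemma Mstar_valP (v : M) : Mstar_space mu (Mstar_val v).
Proof. exact/asboolP/(valP v). Qed.

Lemma Mstar_val_p i (v : M) :
  Mstar_val (act M (heis_p K i) v) = dx i (Mstar_val v).
Proof. exact: ccr_p. Qed.

Lemma Mstar_val_q i (v : M) :
  Mstar_val (act M (heis_q K i) v) = mulx i (Mstar_val v).
Proof. exact: ccr_q. Qed.

Fact xmon_Mstar lam :
  subm_pred (Mstar_space mu : set (monos_module K I)) (xmon (int_shift mu lam)).
Proof. by apply/asboolP/lin_span_gen; exists lam. Qed.

Definition xshift lam : M := SubmElt (Mstar_submodule mu) (xmon_Mstar lam).

Lemma Mstar_val_xshift lam : Mstar_val (xshift lam) = xmon (int_shift mu lam).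
Proof. by []. Qed.

Lemma xshift_q i lam :
  act M (heis_q K i) (xshift lam) = xshift (lam + int_unit i).
Proof.
apply: Mstar_val_inj.
by rewrite Mstar_val_q !Mstar_val_xshift mulx_xmon int_shiftD.
Qed.

Lemma xshift_p i lam :
  act M (heis_p K i) (xshift lam) =
  int_shift mu lam i *: xshift (lam - int_unit i).
Proof.
apply: Mstar_val_inj; rewrite Mstar_val_p Mstar_valZ !Mstar_val_xshift.
by rewrite dx_xmon int_shiftB.
Qed.

Lemma Mstar_level1 : level1 M.
Proof. by move=> v; apply/Mstar_val_inj/ccr_level1. Qed.

(** An induction principle on M_*[mu], applied to a span, to a submodule and to the locus where a
    map respects the action. *)
Lemma xshift_span (S : set M) :
  S 0 -> (forall a u v, S u -> S v -> S (a *: u + v)) ->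
  (forall lam, S (xshift lam)) -> S = setT.
Proof.
move=> S0 SP Sx; apply/seteqP; split=> // v _.
have [s [Ms def_v]] := Mstar_valP v.
(* For each monomial of [s] an integer vector giving it is chosen; one exists, so the default 0 is
   never taken. *)
pose t := [seq (p.1, xget 0 [set lam | xmon (int_shift mu lam) = p.2]) | p <- s].
have -> : v = \sum_(p <- t) p.1 *: xshift p.2.
  apply: Mstar_val_inj; rewrite def_v Mstar_val_sum big_map big_seq [RHS]big_seq.
  apply: eq_bigr => p /Ms [lam _ e]; rewrite Mstar_valZ Mstar_val_xshift.
  congr (_ *: _); apply/esym.
  exact: (@xgetPex _ 0 [set l | xmon (int_shift mu l) = p.2] (ex_intro _ lam e)).
by elim/big_rec: _ => // p u _; apply: SP.
Qed.

Lemma Mstar_diagonalizable i : diagonalizable_op (euler (W := M) i).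
Proof.
exists (range xshift)%classic; split; last first.
  move=> _ [lam _ <-]; exists (int_shift mu lam i).
  by rewrite eulerE xshift_p linearZ /= xshift_q subrK.
split; last first.
  apply: xshift_span => [|a u v|lam]; first exact: lin_span0.
    exact: lin_spanP.
  by apply: lin_span_gen; exists lam.
move=> s s_uniq Bs c /(congr1 Mstar_val) sum0 v vs.
have [lam _ def_v] := Bs v vs.
(* This coefficient isolates [c v], since by [int_shift_inj] the other vectors have other
   exponents. *)
have := congr1 (mon_coef (int_shift mu lam)) sum0.
rewrite linear0 Mstar_val_sum linear_sum (bigD1_seq v) //= -def_v.
rewrite Mstar_valZ linearZ /=.
rewrite Mstar_val_xshift mon_coef_xmon eqxx mulr1.
rewrite big_seq_cond big1 ?addr0 ?linear0 // => u /andP[/Bs [l _ <-] lv].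
rewrite Mstar_valZ linearZ /= Mstar_val_xshift mon_coef_xmon.
case: eqP => [/int_shift_inj e|_]; last by rewrite mulr0.
by rewrite e eqxx in lv.
Qed.

Hypothesis mu0 : F0star mu.

Lemma Mstar_conditionC : conditionC M.
Proof.
split; [exact: Mstar_level1 | exact: Mstar_diagonalizable | |] => i w;
  apply: contraNneq => w0.
- apply/eqP/Mstar_val_inj; rewrite linear0; apply: mon_coefP => nu.
  rewrite linear0; apply/eqP; apply: contraT => nz.
  have [lam def_nu] := (Mstar_spaceP _ _).1 (Mstar_valP w) nu nz.
  (* From p_i w = 0 follows q_i p_i w = 0, so [nu i] times the coefficient vanishes, while [nu i] is
     nonzero. *)
  have := mon_coef_mulx_dx i nu (Mstar_val w).
  rewrite -Mstar_val_p w0 !linear0 => /esym/eqP.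
  by rewrite mulf_eq0 (negPf nz) orbF def_nu (negPf (int_shift_neq0 lam i mu0)).
- apply/eqP/Mstar_val_inj; rewrite linear0; apply: mon_coefP => nu.
  rewrite -[nu](addrK (unit_fun K i)) -mon_coef_mulx -Mstar_val_q w0.
  by rewrite !linear0.
Qed.

Lemma Mstar_irreducible : irreducible M.
Proof.
split.
  exists (xshift 0); apply/eqP.
  move=> /(congr1 (mon_coef (int_shift mu 0) \o Mstar_val)) /=.
  rewrite !linear0 Mstar_val_xshift mon_coef_xmon eqxx => /eqP.
  by rewrite oner_eq0.
move=> S subS; have [S0|/existsNP [w]] := pselect (forall w, S w -> w = 0).
  left; apply/seteqP; split=> [w /S0 ->|_ ->] //; exact: (subm0 subS).
move=> /not_implyP [Sw /eqP w0]; right.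
have SZ a v : S v -> S (a *: v).
  move=> Sv; rewrite -[_ *: _]addr0; apply: (submP subS) => //.
  exact: (subm0 subS).
have [a [u [Su u0 au]]] :=
  joint_eigenvector Mstar_level1 subS Mstar_diagonalizable Sw w0.
(* The Euler operator multiplies the coefficient at [nu] by [nu i], so a nonzero coefficient forces
   [nu i = a i]. *)
have supp_u nu : mon_coef nu (Mstar_val u) != 0 -> nu = a.
  move=> nz; apply/ffunP => i; apply: (mulIf nz).
  rewrite -mon_coef_mulx_dx -Mstar_val_p -Mstar_val_q.
  by rewrite -eulerE au Mstar_valZ linearZ.
have [nu nz] : exists nu, mon_coef nu (Mstar_val u) != 0.
  apply: contrapT => /forallNP u00; move/eqP: u0; apply.
  apply/Mstar_val_inj; rewrite linear0; apply: mon_coefP => nu.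
  by rewrite linear0; apply/eqP/negPn/negP.
have [lam def_nu] := (Mstar_spaceP _ _).1 (Mstar_valP u) nu nz.
have Slam : S (xshift lam).
  have -> : xshift lam = (mon_coef nu (Mstar_val u))^-1 *: u; last exact: SZ.
  apply/Mstar_val_inj/mon_coefP => m.
  rewrite Mstar_valZ linearZ /= Mstar_val_xshift mon_coef_xmon -def_nu.
  case: eqP => [<-|ne]; first by rewrite mulVf.
  have [->|/supp_u ma] := eqVneq (mon_coef m (Mstar_val u)) 0.
    by rewrite mulr0.
  by case: ne; rewrite ma; apply: supp_u.
apply: xshift_span; [exact: (subm0 subS)|exact: (submP subS)|].
apply: lattice_ind Slam => l i Sl.
  by rewrite -xshift_q; apply: (subm_act subS).
(* p_i lowers the exponent up to a nonzero scalar, which is divided out. *)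
rewrite -[xshift _](scalerK (int_shift_neq0 l i mu0)) -xshift_p.
exact/SZ/(subm_act subS).
Qed.

End Mstar.
End Monomials.

(** * Schur's lemma *)

(** Kernel and image are submodules, and [f v0 != 0] rules out a full kernel and a zero image. The
    isomorphism returned is the inverse of [f]. *)
Lemma schur_isomorphic (K : fieldType) (L : lieAlg K) (V W : lieModule L)
    (f : {linear V -> W}) (v0 : V) :
  irreducible V -> irreducible W ->
  (forall x v, f (act V x v) = act W x (f v)) -> f v0 != 0 -> isomorphic W V.
Proof.
move=> [_ irrV] [_ irrW] f_act f0.
have subK : @is_submodule K L V [set v | f v = 0].
  split=> [|a u v /= fu fv|x v /= fv]; first exact: linear0.
    by rewrite linearP fu fv scaler0 addr0.
  by rewrite f_act fv linear0.
have subI : @is_submodule K L W (range f).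
  split=> [|a _ _ [u _ <-] [v _ <-]|x _ [v _ <-]].
  - by exists 0; rewrite ?linear0.
  - by exists (a *: u + v); rewrite ?linearP.
  - by exists (act V x v); rewrite ?f_act.
have injf : injective f.
  move=> u v /eqP; rewrite -subr_eq0 -linearB => /eqP fuv; apply/eqP.
  rewrite -subr_eq0; apply/eqP.
  case: (irrV _ subK) => [/seteqP[K0 _]|KT]; first exact: (K0 _ fuv).
  have : [set v | f v = 0]%classic v0 by rewrite KT.
  by move=> /= fv0; rewrite fv0 eqxx in f0.
have surjf w : exists v, f v = w.
  case: (irrW _ subI) => [I0|IT].
    have : range f (f v0) by exists v0.
    by rewrite I0 => /= fv0; rewrite fv0 eqxx in f0.
  by have : range f w by [rewrite IT]; move=> [v _ <-]; exists v.
have [g gK] := choice surjf.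
have fK : cancel f g by move=> v; apply: injf; rewrite gK.
have lin_g : linear g by exact: (can2_linear fK gK).
pose gL : {linear W -> V} :=
  HB.pack g (GRing.isLinear.Build K W V *:%R g lin_g).
exists gL; split; first by exists f.
by move=> x w; apply: injf; rewrite f_act !gK.
Qed.

(** * Irreducible modules satisfying Condition C *)

Section Converse.
Context {K : fieldType} {I : finType}.
Hypothesis intK_inj : injective (fun z : int => z%:~R : K).
Local Notation expo := {ffun I -> K^o}.

Section LinearExtension.
Context {V : lmodType K} (phi : expo -> V).

(** The analogue of [mon_ext] with values in an arbitrary space. *)
Definition lin_ext (f : monos K I) : V :=
  \sum_(nu <- msupp (f : {malg K[expo]})) mon_coef nu f *: phi nu.

Lemma lin_extEw f (D : {fset expo}) :
  (msupp (f : {malg K[expo]}) `<=` D)%fset ->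
  lin_ext f = \sum_(nu <- D) mon_coef nu f *: phi nu.
Proof.
move=> sD; rewrite /lin_ext (big_fset_incl _ sD) // => nu _ /mcoeff_outdom e.
by rewrite /mon_coef e scale0r.
Qed.

Lemma lin_ext_linear : linear lin_ext.
Proof.
move=> a f g.
pose D := (msupp (f : {malg K[expo]}) `|` msupp (g : {malg K[expo]}))%fset.
rewrite !(@lin_extEw _ D) ?fsubsetUl ?fsubsetUr //; last first.
  apply: fsubset_trans (msuppD_le _ _) _; apply: fsetSU; exact: msuppZ_le.
rewrite scaler_sumr -big_split; apply: eq_bigr => nu _ /=.
by rewrite linearP scalerDl scalerA.
Qed.

Lemma lin_ext_xmon nu : lin_ext (xmon nu) = phi nu.
Proof.
by rewrite (lin_extEw msuppU_le) big_seq_fset1 mon_coef_xmon eqxx scale1r.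
Qed.

End LinearExtension.

Lemma Mstar_lin_ext (V : lmodType K) (mu : expo) (wl : {ffun I -> int} -> V) :
  exists f : {linear Mstar mu -> V}, forall lam, f (xshift mu lam) = wl lam.
Proof.
(* On exponents [int_shift mu lam] the choice of [lam] is unique; elsewhere the default 0 applies,
   on monomials that do not occur in [Mstar mu]. *)
pose phi nu := wl (xget 0 [set lam | int_shift mu lam = nu]).
pose f (v : Mstar mu) := lin_ext phi (Mstar_val v).
have lin_f : linear f.
  by move=> a u v; rewrite /f (linearP (@Mstar_val K I mu)) lin_ext_linear.
pose fL : {linear Mstar mu -> V} :=
  HB.pack f (GRing.isLinear.Build K (Mstar mu) V *:%R f lin_f).
exists fL => lam.
rewrite /= /f Mstar_val_xshift lin_ext_xmon /phi; congr wl.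
apply: (int_shift_inj intK_inj (mu := mu)).
exact: (@xgetPex _ 0 [set l | int_shift mu l = int_shift mu lam]
  (ex_intro _ lam erefl)).
Qed.

Variable W : lieModule (heis K I).
Hypothesis condW : conditionC W.

Let W1 : level1 W := condC_level1 condW.
Let P0 := condC_p condW.
Let Q0 := condC_q condW.

Lemma act_q_inj i : injective (act W (heis_q K i)).
Proof.
move=> u v /eqP uv; apply/eqP; rewrite -subr_eq0; apply: contraTT uv => /(Q0 i).
by rewrite linearB subr_eq0.
Qed.

(** Surjectivity is inherited from q_i p_i, which is diagonalizable and injective. *)
Lemma act_q_bij i : bijective (act W (heis_q K i)).
Proof.
have euler0 (v : W) : v != 0 -> euler i v != 0.
  by move=> v0; apply/(Q0 i)/(P0 i).
have eulerS :=
  diagonalizable_surjective (f := euler i) (condC_diag condW i) euler0.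
have surj v : exists u, act W (heis_q K i) u = v.
  by have [u <-] := eulerS v; exists (act W (heis_p K i) u).
have [g gK] := choice surj.
by exists g => // v; apply: (@act_q_inj i); rewrite gK.
Qed.

(** The [wl lam] behave in [W] like the monomials x^(mu + lam): compare [xshift_q] and
    [xshift_p]. *)
Lemma conditionC_weights :
  (exists w : W, w != 0) ->
  exists (mu : expo) (wl : {ffun I -> int} -> W),
    [/\ F0star mu, forall lam, wl lam != 0,
        forall i lam, wl (lam + int_unit i) = act W (heis_q K i) (wl lam) &
        forall i lam, act W (heis_p K i) (wl lam) =
                      int_shift mu lam i *: wl (lam - int_unit i)].
Proof.
move=> [w w0].
have subT : @is_submodule K (heis K I) W setT by split.
have [mu [u [_ u0 eig_u]]] :=
  joint_eigenvector W1 subT (condC_diag condW) Logic.I w0.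
have [wl [wl0 wlD]] := int_powers act_q_bij (@act_qC _ _ W) u.
have wlB i lam : wl lam = act W (heis_q K i) (wl (lam - int_unit i)).
  by rewrite -wlD subrK.
have wl_neq0 lam : wl lam != 0.
  move: lam; apply: (@lattice_ind _ _ _ _ 0); last by rewrite wl0.
    by move=> lam i; rewrite wlD; apply: Q0.
  by move=> lam i; apply: contraNneq => e; rewrite (wlB i) e linear0.
have eig_wl lam : forall i, euler i (wl lam) = int_shift mu lam i *: wl lam.
  move: lam; apply: (@lattice_ind _ _ _ _ 0) => [lam j IH i|lam j IH i|i].
  - rewrite wlD euler_q // IH -scalerDl linearZ /= int_shiftD !ffunE.
    by rewrite -wlD.
  (* Downwards, [euler_q] is read backwards on [wl lam = q_j (wl (lam - int_unit j))], cancelling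
     the injective q_j. *)
  - apply: (@act_q_inj j); apply: (addIr ((i == j)%:R *: wl lam)).
    have := IH i; rewrite {1}(wlB j) euler_q // linearD /= linearZ /= -wlB => ->.
    rewrite linearZ /= -wlB int_shiftB !ffunE -scalerDl.
    by rewrite subrK.
  - by rewrite wl0 eig_u !ffunE addr0.
exists mu, wl; split=> // [i z mui|i lam].
  (* Were [mu i = z], the constant shift by -z would give a nonzero vector killed by q_i p_i. *)
  have := Q0 i (P0 i (wl_neq0 [ffun=> - z])); rewrite -eulerE eig_wl.
  by rewrite !ffunE mui intrN subrr scale0r eqxx.
(* After applying the injective q_i, the formula for p_i becomes the Euler eigenvalue equation. *)
apply: (@act_q_inj i); rewrite linearZ /= -wlB; exact: eig_wl.
Qed.

Lemma conditionC_Mstar :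
  irreducible W -> exists mu : expo, F0star mu /\ isomorphic W (Mstar mu).
Proof.
move=> irrW; have [mu [wl [mu0 wl0 wlD wl_p]]] := conditionC_weights irrW.1.
exists mu; split=> //.
have [f fx] := Mstar_lin_ext mu wl.
have f_act x v : f (act (Mstar mu) x v) = act W x (f v).
  (* Both sides are linear in [v], so only the [xshift lam] matter, and there [actE] leaves only the
     p_i and q_i to compare. *)
  pose S : set (Mstar mu) := fun v => f (act (Mstar mu) x v) = act W x (f v).
  suff ST : S = setT by have : S v by rewrite ST.
  apply: xshift_span => [|a u' v' eu ev|lam]; rewrite /S.
  - by rewrite !linear0.
  - by rewrite !linearP eu ev.
  - rewrite (actE (@Mstar_level1 _ _ mu)) (actE W1).
    rewrite !linearD !linear_sum linearZ /= !fx.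
    congr (_ + _ + _); apply: eq_bigr => i _.
      by rewrite xshift_p !linearZ /= fx wl_p.
    by rewrite xshift_q linearZ /= fx wlD.
apply: (schur_isomorphic (f := f) (v0 := xshift mu 0)) => //.
  exact: Mstar_irreducible.
by rewrite fx.
Qed.

End Converse.

Theorem proposition2p10 (R : realType) (I0 : finType) (hI0 : (0 < #|I0|)%N) :
  (forall mu : {ffun I0 -> R[i]}, F0star mu ->
     irreducible (Mstar mu) /\ conditionC (Mstar mu)) /\
  (forall W : lieModule (heis R[i] I0),
     irreducible W -> conditionC W ->
     exists mu : {ffun I0 -> R[i]}, F0star mu /\ isomorphic W (Mstar mu)).
Proof.
have inj : injective (fun z : int => z%:~R : R[i]) by exact: intr_inj.
split=> [mu mu0|W irrW condW]; last exact: conditionC_Mstar.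
by split; [exact: Mstar_irreducible | exact: Mstar_conditionC].
Qed.
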